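(* Let $n$ and $k$ be positive integers. The map $\Phi$ (defined in the context) is a weight preserving involution on $A(n,k)$; that is, for every $\Pi\in A(n,k)$ one has $|\Phi(\Pi)|=|\Pi|$ and $\Phi(\Phi(\Pi))=\Pi$.
   Context: An alternating word is a word $a_1a_2\cdots a_m$ of nonnegative integers with $a_1\ge a_2\le a_3\ge a_4\le\cdots$. A $k$-staircase alternating array $\Pi$ consists of $k$ rows of nonnegative integers, each row occupying consecutive columns of a grid, such that each row (read left to right) is an alternating word and, for $1\le i\le k-1$, the last entry of row $i+1$ lies exactly two columns to the right of the last entry of row $i$. Let $\ell_i$ be the number of entries in row $i$ and $\ell_i'=\ell_i-2i+2$. For a positive integer $n$, $\Pi$ is of order $n$ if $\{\ell_i' : 1\le i\le k\}=\{2n+1,2n+3,\ldots,2n+2k-1\}$. $A(n,k)$ is the set of $k$-staircase alternating arrays of order $n$. The permutation associated to $\Pi\in A(n,k)$ is the permutation $\sigma=\sigma_1\cdots\sigma_k$ of $\{1,\dots,k\}$ given by $\sigma_i=(\ell_i'-2n+1)/2$. For $i<j$, $\sigma_i>\sigma_j$ iff row $i$ starts to the left of row $j$. The weight $|\Pi|$ is the sum of all entries of $\Pi$. Transposability and $T_{i,j}$: let $1\le i<j\le k$, and consider the columns occupied by both row $i$ and row $j$ of $\Pi$; there is an odd number $p$ of them, and they are consecutive. They determine $p+1$ positions: immediately before the first common column, between two consecutive common columns, and immediately after the last common column. For each position, exchange the entries of rows $i$ and $j$ lying to the left of this position (entries keep their columns). If both resulting rows are again alternating words, the position is called a cutting position.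 Rows $i$ and $j$ of $\Pi$ are transposable if they have at least one cutting position; in this case $T_{i,j}(\Pi)\in A(n,k)$ is the array obtained from $\Pi$ by exchanging the entries of rows $i$ and $j$ lying to the left of the leftmost cutting position. If $i<j$ and $\sigma_i>\sigma_j$, then rows $i$ and $j$ are always transposable; hence if rows $1,\dots,m_0$ are such that no two consecutive ones are transposable, then $\sigma_1<\cdots<\sigma_{m_0}$. Definition of $\Phi$ on $A(n,k)$: let $\Pi\in A(n,k)$ with associated permutation $\sigma$. If for every $1\le m<k$ rows $m$ and $m+1$ of $\Pi$ are not transposable, set $\Phi(\Pi)=\Pi$. Otherwise let $m_0$ be the smallest index $1\le m_0<k$ such that rows $m_0$ and $m_0+1$ of $\Pi$ are transposable. (A) If $\sigma_{m_0}<\sigma_{m_0+1}$, set $\Phi(\Pi)=T_{m_0,m_0+1}(\Pi)$. (B) If $\sigma_{m_0}>\sigma_{m_0+1}$, let $s$ ($1\le s\le m_0$) be the smallest index with $\sigma_s>\sigma_{m_0+1}$; rows $s$ and $m_0+1$ of $\Pi$ are then transposable. (I) If $s\ge 2$ and rows $s-1$ and $s$ of $T_{s,m_0+1}(\Pi)$ are transposable, then rows $s-1$ and $m_0+1$ of $\Pi$ are transposable, and one sets $\Phi(\Pi)=T_{s-1,m_0+1}(\Pi)$. (II) Otherwise, set $\Phi(\Pi)=T_{s,m_0+1}(\Pi)$. *)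

(* Defs.v *)
From mathcomp Require Import all_boot all_order all_algebra.
Set Implicit Arguments.
Unset Strict Implicit.
Unset Printing Implicit Defensive.
Import Order.TTheory GRing.Theory Num.Theory.

(** An array is the list of its rows, each row being a word.  Rows are numbered
    from 0.  Since the last entries of consecutive rows are exactly two columns
    apart, the words determine the positions of all entries in the grid up to a
    translation; the grid is normalised so that the last entry of row [i] is in
    column [2 * i], columns being indexed by [int]. *)
Definition array := seq (seq nat).

Definition row_of (P : array) (i : nat) : seq nat := nth [::] P i.

Definition weight (P : array) : nat := \sum_(w <- P) \sum_(a <- w) a.

Definition alternating (w : seq nat) : bool :=
  all (fun r => if odd r then nth 0 w r <= nth 0 w r.+1
                else nth 0 w r >= nth 0 w r.+1)
      (iota 0 (size w).-1).

Definition staircase (k : nat) (P : array) : Prop :=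
  size P = k /\ all alternating P.

Local Open Scope ring_scope.

(** This is [l - 2 * i + 2] when rows are numbered from 1. *)
Definition ell' (P : array) (i : nat) : int :=
  (size (row_of P i))%:Z - (2 * i)%:Z.

Definition has_order (n k : nat) (P : array) : Prop :=
  [seq ell' P i | i <- iota 0 k] =i [seq (2 * n + 2 * m + 1)%:Z | m <- iota 0 k].

Definition A (n k : nat) (P : array) : Prop := staircase k P /\ has_order n k P.

(** The associated permutation in one-line notation, with values in {1, ..., k}. *)
Definition sigma (n : nat) (P : array) (i : nat) : int :=
  ((ell' P i - (2 * n)%:Z + 1) %/ 2)%Z.

Definition columns (P : array) (i : nat) : seq int :=
  let l := size (row_of P i) in
  [seq (2 * i)%:Z - l%:Z + 1 + r%:Z | r <- iota 0 l].

Definition common_columns (P : array) (i j : nat) : seq int :=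
  [seq c <- columns P i | c \in columns P j].

(** The position immediately to the left of column [q] is encoded by [q]; the
    positions are listed from left to right. *)
Definition positions (P : array) (i j : nat) : seq int :=
  if common_columns P i j is c :: cs
  then c :: [seq d + 1 | d <- c :: cs] else [::].

Definition left_part (P : array) (i : nat) (q : int) : seq nat :=
  mask [seq c < q | c <- columns P i] (row_of P i).

Definition right_part (P : array) (i : nat) (q : int) : seq nat :=
  mask [seq q <= c | c <- columns P i] (row_of P i).

(** When [q] is one of the [positions P i j] and [i < j], the last entries of the
    two new rows are still in columns [2 * i] and [2 * j], so that with the above
    normalisation of the grid all entries keep their columns. *)
Definition exchange (P : array) (i j : nat) (q : int) : array :=
  mkseq (fun m => if m == i then left_part P j q ++ right_part P i q
                  else if m == j then left_part P i q ++ right_part P j q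
                  else row_of P m)
        (size P).

Definition cutting_positions (P : array) (i j : nat) : seq int :=
  [seq q <- positions P i j |
     alternating (row_of (exchange P i j q) i) &&
     alternating (row_of (exchange P i j q) j)].

Definition transposable (P : array) (i j : nat) : bool :=
  cutting_positions P i j != [::].

(** Outside its intended domain, i.e. when rows [i] and [j] are not transposable,
    [T P i j] is [P] by convention. *)
Definition T (P : array) (i j : nat) : array :=
  if cutting_positions P i j is q :: _ then exchange P i j q else P.

(** [find] returns the smallest suitable index, or the size of the list (here
    [k.-1]) if there is none. *)
Definition Phi (n k : nat) (P : array) : array :=
  let m0 := find (fun m => transposable P m m.+1) (iota 0 k.-1) in
  if m0 == k.-1 then P
  else if sigma n P m0 < sigma n P m0.+1 then T P m0 m0.+1
  else
    let s := find (fun i => sigma n P m0.+1 < sigma n P i) (iota 0 m0.+1) in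
    if (0 < s)%N && transposable (T P s m0.+1) s.-1 s
    then T P s.-1 m0.+1
    else T P s m0.+1.

(* Main.v *)
Require Import Defs.
From mathcomp Require Import all_boot all_order all_algebra.
From mathcomp Require Import zify.

(** Extend every row by zeros to a function on all integer columns.  In an array of
[A n k] the rows start and end in even columns, so that the peaks of all rows
are in the even columns, and the extension by zeros is compatible with the
inequalities at both ends of a row.  Being a cutting position for two rows [f]
and [g] is then a pair of inequalities between their entries in the columns
[q - 1] and [q] ([cut]), without boundary cases.

Scan the common columns of two rows from the left.  If no position up to some
point is a cut, then the row that starts further left is strictly above the
other one at each of these positions ([dominates], [ncut_dominates]).  At the
right end this is impossible when the upper row of the array is the one that
starts further left, so such rows are transposable; and rows [i < j] are not
transposable exactly when row [j] starts further left and dominates row [i]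
throughout ([belowP]).  Also, the exchange at the leftmost cut does not change
which positions further left are cuts, so [T] is an involution on each pair of
transposable rows ([exchangeT]).

Let [m] be the first index such that rows [m] and [m.+1] are transposable.  The
rows [0, .., m] form a chain, each dominated by the next, with starting columns
that decrease, and [Phi] inserts row [m.+1] into this chain.  In each case the
rows [0, .., m] of the image are again a chain and rows [m] and [m.+1] are again
transposable, so the second application starts from the same [m], and it
remains to see that it exchanges the same two rows.
- If row [m.+1] starts left of row [m], the new rows [m] and [m.+1] are in the
  opposite order, and the selected row is [s = m].  Rows [m.-1] and [m] of the
  original array are not transposable, so rows [m] and [m.+1] are exchanged back
  ([Phi_case_increasing]).
- If [Phi] exchanges the selected row [s] with row [m.+1], then the new row
  [m.+1] starts where row [s] did.  For [s = m] the previous case is reached.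
  For [s < m] the row selected in the image is [s.+1], and the transposability
  test made by [Phi] succeeds ([cut_splice_splice]), so that row [s] is used
  ([Phi_case_decreasing]).
- If [Phi] exchanges row [s.-1] with row [m.+1], then the row selected in the
  image is [s.-1], and the test fails since it concerns rows [s.-2] and [s.-1]
  of the original array ([Phi_case_shifted]).  The delicate point is that row
  [s] still dominates the new row [s.-1] ([dominates_splice_shifted]). *)

Set Implicit Arguments.
Unset Strict Implicit.
Unset Printing Implicit Defensive.
Import Order.TTheory GRing.Theory Num.Theory.

(** * Row profiles on the integer columns *)
Section Profiles.
Local Open Scope ring_scope.
Implicit Types (f g h : int -> nat) (a b e p q : int).

(** The inequality asked from consecutive entries [x] in column [q - 1] and [y] in
    column [q] of a row: peaks are in the even columns, for all rows at once. *)
Definition joins q (x y : nat) : bool :=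
  if odd `|q| then (y <= x)%N else (x <= y)%N.

(** All integers [q] are allowed because rows are extended by zeros. *)
Definition zigzag f : Prop := forall q, joins q (f (q - 1)) (f q).

Definition cut f g q : bool :=
  joins q (f (q - 1)) (g q) && joins q (g (q - 1)) (f q).

(** The negation of one of the two inequalities of [cut f g q]: the one that
    fails when [g] is the larger row. *)
Definition dominates g f q : bool :=
  if odd `|q| then (f (q - 1)%R < g q)%N else (f q < g (q - 1)%R)%N.

Definition splice q g f : int -> nat := fun c => if c < q then g c else f c.

Lemma cutC f g q : cut f g q = cut g f q.
Proof. exact: andbC. Qed.

Lemma eq_cut f f' g g' q : f =1 f' -> g =1 g' -> cut f g q = cut f' g' q.
Proof. by rewrite /cut => Ef Eg; rewrite !Ef !Eg. Qed.

Lemma eq_dominates f f' g g' q :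
  f =1 f' -> g =1 g' -> dominates f g q = dominates f' g' q.
Proof. by rewrite /dominates => Ef Eg; rewrite !Ef !Eg. Qed.

Lemma eq_zigzag f f' : f =1 f' -> zigzag f -> zigzag f'.
Proof. by move=> E zf q; rewrite -!E. Qed.

Lemma eq_splice q f f' g g' :
  f =1 f' -> g =1 g' -> splice q f g =1 splice q f' g'.
Proof. by rewrite /splice => Ef Eg c; rewrite Ef Eg. Qed.

Lemma spliceK q f g : splice q (splice q f g) (splice q g f) =1 f.
Proof. by rewrite /splice => c; case: (c < q). Qed.

Lemma zigzag_splice q f g :
  zigzag f -> zigzag g -> joins q (g (q - 1)) (f q) -> zigzag (splice q g f).
Proof.
move=> zf zg jq p; rewrite /splice; have := zf p; have := zg p.
case: (ltP p q) => [pq|qp]; first by rewrite (_ : p - 1 < q) //; lia.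
case: (ltP (p - 1) q) => // pq.
have -> : p = q by lia.
by [].
Qed.

Lemma zigzag_splice_joins q f g :
  zigzag (splice q g f) -> joins q (g (q - 1)) (f q).
Proof.
by move/(_ q); rewrite /splice ltxx; have -> : q - 1 < q by lia.
Qed.

Lemma cut_splice_lt q p f g :
  p < q -> cut (splice q g f) (splice q f g) p = cut f g p.
Proof.
move=> pq; rewrite [RHS]cutC /cut /splice; have -> : p - 1 < q by lia.
by rewrite pq.
Qed.

(** The position of an exchange remains a cut: exchanging there again restores
    the two rows. *)
Lemma cut_splice q f g :
  zigzag f -> zigzag g -> cut (splice q g f) (splice q f g) q.
Proof.
move=> zf zg; rewrite /cut /splice ltxx; have -> : q - 1 < q by lia.
by rewrite zf zg.
Qed.

Lemma dominates_ncut f g q : dominates g f q -> ~~ cut f g q.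
Proof. by rewrite /dominates /cut /joins; case: ifP => _; lia. Qed.

(** Induction on the position: as [f] is zero before [a], the only inequality
    of a cut that can fail at [a] is the one giving [dominates g f a]; and
    if [g] dominates [f] at one position, the zigzags force one of the two
    inequalities of a cut at the next position, hence the other one fails. *)
Lemma ncut_dominates f g a b : ~~ odd `|a| -> zigzag f -> zigzag g ->
    f (a - 1) = 0%N -> (forall p, a <= p < b -> ~~ cut f g p) ->
  forall p, a <= p < b -> dominates g f p.
Proof.
move=> ea zf zg f0 nc p /andP[ap pb].
have [n En] : exists n : nat, p = a + n%:Z by exists `|p - a|%N; lia.
elim: n => [|n IHn] in p En ap pb *.
  have := nc p; rewrite ap pb => /(_ isT).
  have -> : p = a by lia.
  by rewrite /cut /dominates /joins (negbTE ea) f0 -ltnNge.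
have := IHn (p - 1); have := nc p; rewrite ap pb => /(_ isT) ncp.
move=> /(_ ltac:(lia) ltac:(lia) ltac:(lia)).
have := zf (p - 1); have := zg (p - 1); have := zf p; have := zg p.
move: ncp; rewrite /cut /dominates /joins.
have -> : odd `|p - 1| = ~~ odd `|p| by lia.
by case: odd => /=; lia.
Qed.

(** Otherwise [g] would dominate [f] at the odd position [b], hence have a
    positive entry in column [b]. *)
Lemma cut_exists f g a b : ~~ odd `|a| -> odd `|b| -> a <= b ->
    zigzag f -> zigzag g -> f (a - 1) = 0%N -> g b = 0%N ->
  exists2 q, a <= q <= b & cut f g q.
Proof.
move=> ea ob ab zf zg f0 g0.
have [n En] : exists n : nat, b = a + n%:Z by exists `|b - a|%N; lia.
have [/hasP[m]|/hasPn nc] := boolP (has (fun m : nat => cut f g (a + m%:Z)) (iota 0 n.+1)).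
  by rewrite mem_iota => mn cm; exists (a + m%:Z) => //; lia.
suff : dominates g f b by rewrite /dominates ob g0.
apply: (@ncut_dominates f g a (b + 1)) => // [p pab|]; last by lia.
have /nc : `|p - a|%N \in iota 0 n.+1 by rewrite mem_iota; lia.
by have -> : a + `|p - a|%N = p by lia.
Qed.

(** Left of [q] the row [g] is above [f], and therefore above whatever [f]
    dominates.  This compares the new row of an exchange with the row before
    it. *)
Lemma dominates_splice_above F f g a b e q : zigzag f -> a < b ->
    (forall p, b <= p <= e -> dominates f F p) ->
    (forall p, a <= p < q -> dominates g f p) ->
  forall p, b <= p <= e -> dominates (splice q g f) F p.
Proof.
move=> zf ab dF dg p pbe; have := dF p pbe; rewrite /dominates /splice.
have [op|ep] := boolP (odd `|p|).
  case: ifP => [pq|_]; last by lia.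
  have := dg p; have := zf p.
  by rewrite /dominates /joins op; lia.
case: ifP => [pq|_]; last by lia.
have := zf p; rewrite /joins (negbTE ep).
case: (ltP p q) => [pq'|qp]; first by have := dg p; rewrite /dominates (negbTE ep); lia.
have := zf (p - 1); have := dg (p - 1).
rewrite /dominates /joins; have -> : odd `|p - 1| by lia.
by move=> /=; lia.
Qed.

(** Left of [q] the row [g] is below [f], and therefore below whatever dominates
    [f].  This compares the new row of an exchange with the row after it. *)
Lemma dominates_splice_below h f g a b e q : zigzag f -> ~~ odd `|a| ->
    b <= a ->
    (forall p, b <= p <= e -> dominates h f p) ->
    (forall p, a <= p < q -> dominates f g p) ->
  forall p, a <= p <= e -> dominates h (splice q g f) p.
Proof.
move=> zf ea ba dh dg p pae; have := dh p; rewrite /dominates /splice.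
have [op|ep] := boolP (odd `|p|); last first.
  case: ifP => [pq|_]; last by lia.
  have := dg p; have := zf p.
  by rewrite /dominates /joins (negbTE ep); lia.
case: ifP => [pq|_]; last by lia.
have := zf (p - 1); have := dg (p - 1).
rewrite /dominates /joins; have -> : odd `|p - 1| = false by lia.
move=> /=.
have ap : a < p by case: (ltgtP a p) => //; lia.
by lia.
Qed.

(** Each inequality of dominance involves a single entry of the dominating row,
    which comes from either [f] or [g]. *)
Lemma dominates_splice F f g q p :
  dominates f F p -> dominates g F p -> dominates (splice q g f) F p.
Proof. by rewrite /dominates /splice; case: ifP => _; case: ifP. Qed.

(** Used for [f], [h] and [g] the rows [s], [s.+1] and [m.+1]: after the exchange
    of [f] and [g] at [q], and that of [h] with the resulting row at [q'], the
    position [q] is a cut for the new rows [s] and [s.+1].  Since [h] dominates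
    [f], the second cut [q'] cannot be left of [q].  If it is right of [q], the
    two new rows around [q] still come from [g] and [f] only.  If it equals [q],
    then [q] is even, and [h] is above [f], hence above [g], there. *)
Lemma cut_splice_splice f g h a e q q' :
    zigzag f -> zigzag g -> zigzag h -> a <= q' -> q <= e ->
    (forall p, a <= p <= e -> dominates h f p) ->
    cut f g q -> cut h (splice q f g) q' ->
  cut (splice q g f) (splice q' (splice q f g) h) q.
Proof.
move=> zf zg zh aq' qe dh; rewrite /cut /splice ltxx.
have -> : q - 1 < q by lia.
have := zf q; have := zg q; case: (ltgtP q q') => [qq'|q'q|E]; last rewrite -E in aq' *.
- have -> : q - 1 < q' by lia.
  by move=> -> ->.
- have -> : q' - 1 < q by lia.
  by have := dh q'; rewrite /dominates /joins; case: ifP => _; lia.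
have -> : q - 1 < q by lia.
have := dh q; have := zh q; rewrite /dominates /joins.
by case: ifP => _; lia.
Qed.

(** Used for [F], [f] and [g] the rows [s.-1], [s] and [m.+1], with [q] and [q']
    the leftmost cuts of [f] and of [F] with [g].  The position [c] witnesses
    that [F] can be transposed with the row that [f] becomes.  As [f] dominates
    [F], the failure at [c] comes from an entry of [g]: thus [c] is left of [q],
    or equal to [q] and even; and [c] is not left of [q'], before which [g]
    dominates [F].  So [q'] is left of [q], or equal to [q] and even, and
    wherever the new row shows entries of [g] it stays below [f]. *)
Lemma dominates_splice_shifted F f g a b e q q' c : a <= b ->
    (forall p, b <= p <= e -> dominates f F p) ->
    (forall p, a <= p < q -> dominates f g p) ->
    (forall p, b <= p < q' -> dominates g F p) ->
    b <= c <= e -> ~~ dominates (splice q g f) F c -> b <= q' ->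
  forall p, a <= p <= e -> dominates f (splice q' g F) p.
Proof.
move=> ab df dfg dg bce nd bq' p ape.
have [q'q [q'eq|q'lt]] : q' <= q /\ (~~ odd `|q'| \/ q' < q).
  move: nd; rewrite /dominates /splice; case: ifP => [oc|ec].
    case: ifP => cq; last by have := df c; rewrite /dominates oc; lia.
    by have := dg c; rewrite /dominates oc; lia.
  case: ifP => cq; last by have := df c; rewrite /dominates ec; lia.
  by have := dg c; rewrite /dominates ec; lia.
all: have := df p; have := dfg p; rewrite /dominates /splice.
all: case: ifP => [op|ep]; case: ifP => pq'; lia.
Qed.

End Profiles.

(** * Words as profiles *)
Section Words.
Local Open Scope ring_scope.
Implicit Types (a b p q : int) (u w : seq nat).

(** The zeros outside of the word make the inequalities at its two ends hold
    automatically, since rows begin and end with a peak. *)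
Definition entry a w : int -> nat :=
  fun c => if a <= c then nth 0%N w `|c - a| else 0%N.

Lemma entry_left a w : entry a w (a - 1) = 0%N.
Proof. by rewrite /entry; case: ifP => //; lia. Qed.

Lemma entry_right a w c : a + (size w)%:Z <= c -> entry a w c = 0%N.
Proof.
by move=> h; rewrite /entry; case: ifP => // _; rewrite nth_default //; lia.
Qed.

Lemma entry_shift a w (r : nat) : entry a w (a + r%:Z) = nth 0%N w r.
Proof. by rewrite /entry ifT; [congr nth; lia | lia]. Qed.

(** The starting column is even and the length is odd, so that the peaks are in
    even columns and both ends are peaks. *)
Lemma alternating_zigzag a w : ~~ odd `|a| -> odd (size w) ->
  alternating w <-> zigzag (entry a w).
Proof.
move=> ea ow; split=> [/allP alt q|zw].
  rewrite /joins; case: (ltgtP q a) => qa.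
  - have low c : c < a -> entry a w c = 0%N by rewrite /entry ltNge; case: ifP.
    by rewrite !low ?leqnn ?if_same //; lia.
  - set r := `|(q - 1 - a)%R|%N.
    have -> : q = a + r.+1%:Z by lia.
    have -> : a + r.+1%:Z - 1 = a + r%:Z by lia.
    rewrite !entry_shift; have -> : odd `|a + r.+1%:Z| = ~~ odd r by lia.
    have [rw|wr] := ltnP r (size w).-1.
      by have := alt r; rewrite mem_iota rw /= => /(_ isT); case: odd.
    rewrite [nth 0%N w r.+1]nth_default; last by lia.
    by case: ifP => //= /negbFE odr; rewrite nth_default //; lia.
  by rewrite qa (negbTE ea) entry_left.
apply/allP => r; rewrite mem_iota => rw.
have := zw (a + r.+1%:Z); rewrite /joins.
have -> : a + r.+1%:Z - 1 = a + r%:Z by lia.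
rewrite !entry_shift; have -> : odd `|a + r.+1%:Z| = ~~ odd r by lia.
by case: odd.
Qed.

(** The lengths have to be compared separately, as a word may end with zeros. *)
Lemma entry_inj a u w : size u = size w -> entry a u =1 entry a w -> u = w.
Proof.
move=> suw euw; apply: (@eq_from_nth _ 0%N) => // r ru.
by have := euw (a + r%:Z); rewrite !entry_shift.
Qed.

Lemma entry_splice a b q u w : a <= q -> b <= q -> (`|q - a| <= size u)%N ->
  entry a (take `|q - a| u ++ drop `|q - b| w)
    =1 splice q (entry a u) (entry b w).
Proof.
move=> aq bq qu c; rewrite /entry /splice nth_cat size_takel //.
case: (ltP c q) => cq.
  case: ifP => // ac; rewrite ifT; last by lia.
  by rewrite nth_take //; lia.
have -> : a <= c by lia.
have -> : b <= c by lia.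
have -> : (`|c - a| < `|q - a|)%N = false by lia.
by rewrite nth_drop; congr nth; lia.
Qed.

Lemma mask_iota_lt m d w :
  mask [seq r < d | r <- iota m (size w)]%N w = take (d - m) w.
Proof.
elim: w m => [|x w IHw] m //=; rewrite IHw.
case: ltnP => md; first by have -> : (d - m = (d - m.+1).+1)%N by lia.
have -> : (d - m = 0)%N by lia.
have -> : (d - m.+1 = 0)%N by lia.
by rewrite take0.
Qed.

Lemma mask_iota_ge m d w :
  mask [seq d <= r | r <- iota m (size w)]%N w = drop (d - m) w.
Proof.
elim: w m => [|x w IHw] m //=; rewrite IHw.
case: leqP => md; last by have -> : (d - m = (d - m.+1).+1)%N by lia.
have -> : (d - m = 0)%N by lia.
have -> : (d - m.+1 = 0)%N by lia.
by rewrite drop0.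
Qed.

End Words.

(** * Columns and positions of the rows of an array *)
Section Rows.
Local Open Scope ring_scope.
Implicit Types (P : array) (i j m : nat) (q : int).

Definition start P i : int := (2 * i)%:Z - (size (row_of P i))%:Z + 1.

Definition ent P i : int -> nat := entry (start P i) (row_of P i).

Lemma left_partE P i q : start P i <= q ->
  left_part P i q = take `|q - start P i| (row_of P i).
Proof.
move=> aq; rewrite /left_part /columns -map_comp -[`|_|%N]subn0.
rewrite -mask_iota_lt; congr mask; apply: eq_map => r /=.
by rewrite -/(start P i); lia.
Qed.

Lemma right_partE P i q : start P i <= q ->
  right_part P i q = drop `|q - start P i| (row_of P i).
Proof.
move=> aq; rewrite /right_part /columns -map_comp -[`|_|%N]subn0.
rewrite -mask_iota_ge; congr mask; apply: eq_map => r /=.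
by rewrite -/(start P i); lia.
Qed.

(** The positions of two rows are listed from left to right, so the head of the
    list of cutting positions is the leftmost one. *)
Lemma filter_shift_iota (b : pred int) (c : int) N :
  if [seq q <- [seq c + r%:Z | r <- iota 0 N] | b q] is q :: _ then
    [/\ c <= q < c + N%:Z, b q & forall p : int, c <= p < q -> ~~ b p]
  else forall p : int, c <= p < c + N%:Z -> ~~ b p.
Proof.
elim: N => [|N IHN] in c *; first by move=> p; lia.
rewrite /= addr0 -[1%N]addn0 iotaDl -map_comp.
rewrite (@eq_map _ _ _ (fun r => c + 1 + r%:Z)) => [|r /=]; last by lia.
have := IHN (c + 1); case: ifP => bc; first by move=> _; split=> // [|p]; lia.
have low p : c <= p -> p < c + 1 -> ~~ b p by move=> *; have -> : p = c; rewrite ?bc; lia.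
case: filter => [H p pN|q s [H1 H2 H3]].
  by case: (ltP p (c + 1)) => pc; [apply: low; lia|apply: H; lia].
split=> // [|p pq]; first lia.
by case: (ltP p (c + 1)) => pc; [apply: low; lia|apply: H3; lia].
Qed.

Lemma mem_columns P i c : (c \in columns P i) = (start P i <= c <= (2 * i)%:Z).
Proof.
apply/mapP/idP => [[r]|c_i].
  by rewrite mem_iota => ri ->; rewrite -/(start P i) /start; lia.
exists `|c - start P i|%N; first by rewrite mem_iota; move: c_i; rewrite /start; lia.
by rewrite -/(start P i); lia.
Qed.

(** Row [j] ends to the right of row [i], so only the beginnings matter. *)
Lemma common_columnsE P i j (M := Num.max (start P i) (start P j)) :
    (i < j)%N -> M <= (2 * i)%:Z ->
  common_columns P i j = [seq M + r%:Z | r <- iota 0 `|(2 * i).+1%:Z - M|%N].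
Proof.
move=> ij Mi; pose d := `|M - start P i|%N.
have -> : `|(2 * i).+1%:Z - M|%N = (size (row_of P i) - d)%N.
  by move: Mi; rewrite /d /M /start; lia.
rewrite /common_columns {1}/columns filter_map.
have -> : [seq r <- iota 0 (size (row_of P i)) |
   preim (fun r : nat => start P i + r) [in columns P j] r]
   = iota d (size (row_of P i) - d).
  have {1}-> : size (row_of P i) = (d + (size (row_of P i) - d))%N.
    by move: Mi; rewrite /d /M /start; lia.
  rewrite iotaD filter_cat add0n (eq_in_filter (a2 := pred0)).
    rewrite filter_pred0; apply/all_filterP/allP => r.
    by rewrite mem_iota /= mem_columns; move: Mi; rewrite /d /M /start; lia.
  move=> r; rewrite mem_iota /= mem_columns; move: Mi; rewrite /d /M /start; lia.
rewrite -[X in iota X]addn0 iotaDl -map_comp; apply: eq_map => r /=.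
by rewrite -/(start P i) /d; lia.
Qed.

Lemma positionsE P i j (M := Num.max (start P i) (start P j)) :
    (i < j)%N -> M <= (2 * i)%:Z ->
  positions P i j = [seq M + r%:Z | r <- iota 0 `|(2 * i).+2%:Z - M|%N].
Proof.
move=> ij Mi; rewrite /positions common_columnsE // -/M.
have -> : `|(2 * i).+2%:Z - M|%N = `|(2 * i).+1%:Z - M|%N.+1 by lia.
have : (0 < `|(2 * i).+1%:Z - M|)%N by lia.
case: `|(2 * i).+1%:Z - M|%N => // N _.
have -> : iota 0 N.+2 = 0%N :: map (addn 1%N) (iota 0 N.+1) by rewrite -(iotaDl 1 0).
rewrite map_cons.
rewrite -[LHS]/(M + 0%:Z :: [seq d + 1 | d <- [seq M + r%:Z | r <- iota 0 N.+1]]).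
by congr cons; rewrite -!map_comp; apply: eq_map => r /=; lia.
Qed.

End Rows.

(** * Arrays of order [n] and the exchange of left parts *)
Section Arrays.
Local Open Scope ring_scope.
Implicit Types (P : array) (i j m : nat) (q : int).

Lemma startE P i : start P i = 1 - ell' P i.
Proof. by rewrite /start /ell'; lia. Qed.

Lemma A_size n k P : A n k P -> size P = k.
Proof. by case=> -[]. Qed.

Lemma A_ell' n k P i : A n k P -> (i < k)%N ->
  exists2 m, (m < k)%N & ell' P i = (2 * n + 2 * m + 1)%:Z.
Proof.
case=> _ ord ik; have : ell' P i \in [seq ell' P i | i <- iota 0 k].
  by rewrite map_f // mem_iota.
by rewrite ord => /mapP[m]; rewrite mem_iota; exists m.
Qed.

Lemma A_start_even n k P i : A n k P -> (i < k)%N -> ~~ odd `|start P i|.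
Proof. by move=> AP ik; have [m _] := A_ell' AP ik; rewrite startE; lia. Qed.

Lemma A_start_le0 n k P i : A n k P -> (i < k)%N -> start P i <= 0.
Proof. by move=> AP ik; have [m _] := A_ell' AP ik; rewrite startE; lia. Qed.

Lemma A_odd_size n k P i : A n k P -> (i < k)%N -> odd (size (row_of P i)).
Proof. by move=> AP ik; have := A_start_even AP ik; rewrite /start; lia. Qed.

Lemma A_alternating n k P i : A n k P -> (i < k)%N -> alternating (row_of P i).
Proof. by move=> [[sP /allP alt] _] ik; apply/alt/mem_nth; rewrite sP. Qed.

Lemma A_zigzag n k P i : A n k P -> (i < k)%N -> zigzag (ent P i).
Proof.
move=> AP ik; apply/alternating_zigzag; first exact: A_start_even AP ik.
  exact: A_odd_size AP ik.
exact: A_alternating AP ik.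
Qed.

(** The starting columns take [k] distinct values on [k] rows. *)
Lemma A_start_inj n k P i j : A n k P -> (i < k)%N -> (j < k)%N ->
  start P i = start P j -> i = j.
Proof.
move=> [_ ord] ik jk; rewrite !startE => Eij.
have : uniq [seq ell' P i | i <- iota 0 k].
  rewrite -(@eq_uniq _ _ _ _ (fun x => esym (ord x))) ?size_map //.
  by rewrite map_inj_uniq ?iota_uniq // => a b /= E; lia.
move=> U; apply/eqP; rewrite -(nth_uniq 0 _ _ U) ?size_map ?size_iota //.
by rewrite !(nth_map 0%N) ?size_iota // !nth_iota // !add0n; apply/eqP; lia.
Qed.

(** The permutation is only used through this comparison. *)
Lemma A_sigma_lt n k P i j : A n k P -> (i < k)%N -> (j < k)%N ->
  (sigma n P i < sigma n P j) = (start P j < start P i).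
Proof.
move=> AP ik jk; have := A_start_even AP ik; have := A_start_even AP jk.
by rewrite /sigma !startE; lia.
Qed.

Lemma ent_left P i : ent P i (start P i - 1) = 0%N.
Proof. exact: entry_left. Qed.

Lemma ent_right P i c : (2 * i).+1%:Z <= c -> ent P i c = 0%N.
Proof. by move=> ic; apply: entry_right; rewrite /start; lia. Qed.

Lemma array_ext P P' : size P = size P' ->
    (forall i, (i < size P)%N -> start P i = start P' i) ->
    (forall i, (i < size P)%N -> ent P i =1 ent P' i) -> P = P'.
Proof.
move=> sP Es Ee; apply: (@eq_from_nth _ [::]) => // i iP.
apply: (@entry_inj (start P i)) => [|c].
  by have := Es i iP; rewrite /start /row_of; lia.
by have := Ee i iP c; rewrite /ent -Es.
Qed.

Definition position P i j q : bool :=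
  [&& start P i <= q, start P j <= q & q <= (2 * i).+1%:Z].

Section Exchange.
Variables (P : array) (i j : nat) (q : int).
Hypotheses (ij : (i < j)%N) (jP : (j < size P)%N) (pq : position P i j q).

Let P' := exchange P i j q.

Lemma size_exchange : size P' = size P.
Proof. by rewrite size_mkseq. Qed.

Lemma row_exchange_left :
  row_of P' i = take `|q - start P j| (row_of P j) ++ drop `|q - start P i| (row_of P i).
Proof.
case/and3P: pq => qi qj _.
by rewrite /row_of nth_mkseq ?eqxx ?left_partE ?right_partE //; lia.
Qed.

Lemma row_exchange_right :
  row_of P' j = take `|q - start P i| (row_of P i) ++ drop `|q - start P j| (row_of P j).
Proof.
case/and3P: pq => qi qj _; rewrite /row_of nth_mkseq //.
by rewrite ifF ?eqxx ?left_partE ?right_partE //; lia.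
Qed.

Lemma row_exchange_other m : m != i -> m != j -> row_of P' m = row_of P m.
Proof.
move=> /negbTE mi /negbTE mj; rewrite /row_of.
have [mP|Pm] := ltnP m (size P); first by rewrite nth_mkseq // mi mj.
by rewrite !nth_default // size_exchange.
Qed.

Lemma start_exchange_left : start P' i = start P j.
Proof.
rewrite /start row_exchange_left size_cat size_takel ?size_drop; last first.
  by move: pq; rewrite /position /start; lia.
by move: pq; rewrite /position /start; lia.
Qed.

Lemma start_exchange_right : start P' j = start P i.
Proof.
rewrite /start row_exchange_right size_cat size_takel ?size_drop; last first.
  by move: pq; rewrite /position /start; lia.
by move: pq; rewrite /position /start; lia.
Qed.

Lemma start_exchange_other m : m != i -> m != j -> start P' m = start P m.
Proof. by move=> mi mj; rewrite /start row_exchange_other. Qed.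

Lemma ent_exchange_left : ent P' i =1 splice q (ent P j) (ent P i).
Proof.
rewrite /ent row_exchange_left start_exchange_left.
by apply: entry_splice; move: pq; rewrite /position /start; lia.
Qed.

Lemma ent_exchange_right : ent P' j =1 splice q (ent P i) (ent P j).
Proof.
rewrite /ent row_exchange_right start_exchange_right.
by apply: entry_splice; move: pq; rewrite /position /start; lia.
Qed.

Lemma ent_exchange_other m : m != i -> m != j -> ent P' m = ent P m.
Proof. by move=> mi mj; rewrite /ent start_exchange_other // row_exchange_other. Qed.

Lemma weight_exchange : weight P' = weight P.
Proof.
have weightE Q : weight Q = (\sum_(m < size Q) sumn (row_of Q m))%N.
  rewrite /weight (big_nth [::]) big_mkord; apply: eq_bigr => m _.
  by rewrite sumnE.
have iP : (i < size P)%N by lia.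
have split_sum (F : nat -> nat) : (\sum_(m < size P) F m =
    F i + (F j + \sum_(m < size P | (val m != i) && (val m != j)) F m))%N.
  rewrite (bigD1 (Ordinal iP)) //= (bigD1 (Ordinal jP)) //=.
  by rewrite -val_eqE /=; lia.
rewrite !weightE size_exchange (split_sum (fun m => sumn (row_of P' m))).
rewrite (split_sum (fun m => sumn (row_of P m))).
rewrite row_exchange_left row_exchange_right !sumn_cat.
have take_drop (d : nat) s : (sumn (take d s) + sumn (drop d s))%N = sumn s.
  by rewrite -sumn_cat cat_take_drop.
rewrite (eq_bigr (fun m : 'I_(size P) => sumn (row_of P m))); last first.
  by move=> m /andP[mi mj]; rewrite row_exchange_other.
have := take_drop `|q - start P i|%N (row_of P i).
have := take_drop `|q - start P j|%N (row_of P j).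
by rewrite !addnA => *; congr addn; lia.
Qed.

End Exchange.

(** The parts of both new rows are alternating, so only the two junctions at [q]
    can fail. *)
Lemma alternating_exchange n k P i j q :
    A n k P -> (i < j < k)%N -> position P i j q ->
  alternating (row_of (exchange P i j q) i) &&
    alternating (row_of (exchange P i j q) j) = cut (ent P i) (ent P j) q.
Proof.
move=> AP /andP[ij jk] pq; have ik : (i < k)%N by lia.
have jP : (j < size P)%N by rewrite (A_size AP).
have zi := A_zigzag AP ik; have zj := A_zigzag AP jk.
have oi := A_odd_size AP ik; have oj := A_odd_size AP jk.
have ei := A_start_even AP ik; have ej := A_start_even AP jk.
have si := start_exchange_left ij jP pq; have sj := start_exchange_right ij jP pq.
have Hi : alternating (row_of (exchange P i j q) i)
    <-> zigzag (splice q (ent P j) (ent P i)).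
  rewrite (@alternating_zigzag (start P j)) //; last first.
    by move: si; rewrite {1}/start; lia.
  have := ent_exchange_left ij jP pq; rewrite /ent si => E.
  by split; apply: eq_zigzag => // c; rewrite E.
have Hj : alternating (row_of (exchange P i j q) j)
    <-> zigzag (splice q (ent P i) (ent P j)).
  rewrite (@alternating_zigzag (start P i)) //; last first.
    by move: sj; rewrite {1}/start; lia.
  have := ent_exchange_right ij jP pq; rewrite /ent sj => E.
  by split; apply: eq_zigzag => // c; rewrite E.
apply/andP/andP => -[].
  by move=> /Hi/zigzag_splice_joins ? /Hj/zigzag_splice_joins ?.
by move=> ji jj; split; [apply/Hi|apply/Hj] => //; apply: zigzag_splice.
Qed.

End Arrays.

(** * Transposable rows and the leftmost cut *)
Section Transposition.
Local Open Scope ring_scope.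
Implicit Types (P : array) (i j m : nat) (p q : int).

Definition first_cut P i j q : Prop :=
  [/\ position P i j q, cut (ent P i) (ent P j) q
    & forall p, position P i j p -> p < q -> ~~ cut (ent P i) (ent P j) p].

Lemma cutting_positionsP n k P i j : A n k P -> (i < j < k)%N ->
  if cutting_positions P i j is q :: _ then first_cut P i j q
  else forall p, position P i j p -> ~~ cut (ent P i) (ent P j) p.
Proof.
move=> AP ijk; have [ij jk] := andP ijk; have ik : (i < k)%N by lia.
have si := A_start_le0 AP ik; have sj := A_start_le0 AP jk.
pose M := Num.max (start P i) (start P j).
have Mi : M <= (2 * i)%:Z by rewrite /M; lia.
pose N := `|(2 * i).+2%:Z - M|%N.
have posE q : position P i j q = (M <= q < M + N%:Z).
  by rewrite /position /N /M; lia.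
rewrite /cutting_positions positionsE // -/M -/N.
rewrite (@eq_in_filter _ _ (cut (ent P i) (ent P j))); last first.
  move=> q /mapP[r]; rewrite mem_iota => rN ->.
  by apply: alternating_exchange AP _ _ => //; rewrite posE; lia.
have := filter_shift_iota (cut (ent P i) (ent P j)) M N.
case: filter => [H p|q s [Mq cq H]]; first by rewrite posE; apply: H.
split; rewrite ?posE // => p; rewrite posE => pM pq; apply: H; lia.
Qed.

Lemma transposableP n k P i j : A n k P -> (i < j < k)%N ->
  transposable P i j <->
    exists2 q, position P i j q & cut (ent P i) (ent P j) q.
Proof.
move=> AP ijk; have := cutting_positionsP AP ijk; rewrite /transposable.
case: cutting_positions => [H|q s [pq cq _]].
  by split=> // -[p /H/negbTE ->].
by split=> // _; exists q.
Qed.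

Lemma T_first_cut n k P i j : A n k P -> (i < j < k)%N -> transposable P i j ->
  exists2 q, first_cut P i j q & T P i j = exchange P i j q.
Proof.
move=> AP ijk; have := cutting_positionsP AP ijk; rewrite /transposable /T.
by case: cutting_positions => // q s H _; exists q.
Qed.

Lemma T_first_cutE n k P i j q : A n k P -> (i < j < k)%N ->
  first_cut P i j q -> T P i j = exchange P i j q.
Proof.
move=> AP ijk [pq cq nq].
have [|p [pp cp np] ->] := T_first_cut AP ijk; first by apply/(transposableP AP ijk); exists q.
congr exchange; apply/eqP; case: (ltgtP p q) => // [pq'|qp].
  by have := nq p pp pq'; rewrite cp.
by have := np q pq qp; rewrite cq.
Qed.

(** Row [i] is zero in the column [2 * i + 1] after its end, so it cannot
    dominate row [j] at that position. *)
Lemma transposable_start n k P i j : A n k P -> (i < j < k)%N ->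
  start P i < start P j -> transposable P i j.
Proof.
move=> AP ijk sij; have [ij jk] := andP ijk; have ik : (i < k)%N by lia.
apply/(transposableP AP ijk); have sj := A_start_le0 AP jk.
have [|||||||q] := @cut_exists (ent P j) (ent P i) (start P j) (2 * i).+1%:Z.
- exact: A_start_even AP jk.
- by lia.
- by lia.
- exact: A_zigzag AP jk.
- exact: A_zigzag AP ik.
- exact: ent_left.
- by apply: ent_right; lia.
by move=> jq; rewrite cutC; exists q => //; rewrite /position; lia.
Qed.

(** For [i < j] in an array of [A n k] this says that rows [i] and [j] are not
    transposable, see [belowP]. *)
Definition below P i j : Prop :=
  start P j < start P i /\
  forall p, start P i <= p <= (2 * i).+1%:Z -> dominates (ent P j) (ent P i) p.

(** Rows that cannot be cut anywhere cannot start in the order that forces a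
    cut, and the row starting further left dominates on all positions. *)
Lemma belowP n k P i j : A n k P -> (i < j < k)%N ->
  below P i j <-> ~~ transposable P i j.
Proof.
move=> AP ijk; have [ij jk] := andP ijk; have ik : (i < k)%N by lia.
have zi := A_zigzag AP ik; have zj := A_zigzag AP jk.
split=> [[sji dji]|].
  apply/negP => /(transposableP AP ijk)[q pq]; apply/negP/dominates_ncut.
  by apply: dji; move: pq; rewrite /position; lia.
move=> nt; have sji : start P j < start P i.
  case: (ltgtP (start P i) (start P j)) => // [sij|eij].
    by rewrite (transposable_start AP ijk sij) in nt.
  by have := A_start_inj AP ik jk eij; lia.
split=> // p ip.
apply: (@ncut_dominates _ _ (start P i) ((2 * i).+1%:Z + 1)) => //.
- exact: A_start_even AP ik.
- exact: ent_left.
- move=> p' ip'; apply: contraNN nt => cp; apply/(transposableP AP ijk).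
  by exists p' => //; rewrite /position; lia.
by lia.
Qed.

Lemma first_cut_dominates n k P i j q : A n k P -> (i < j < k)%N ->
    first_cut P i j q -> start P i < start P j ->
  forall p, start P j <= p < q -> dominates (ent P i) (ent P j) p.
Proof.
move=> AP ijk [pq cq nq] sij; have [ij jk] := andP ijk; have ik : (i < k)%N by lia.
apply: ncut_dominates.
- exact: A_start_even AP jk.
- exact: A_zigzag AP jk.
- exact: A_zigzag AP ik.
- exact: ent_left.
by move=> p jp; rewrite cutC; apply: nq; move: pq; rewrite /position; lia.
Qed.

Lemma first_cut_dominated n k P i j q : A n k P -> (i < j < k)%N ->
    first_cut P i j q -> start P j < start P i ->
  forall p, start P i <= p < q -> dominates (ent P j) (ent P i) p.
Proof.
move=> AP ijk [pq cq nq] sij; have [ij jk] := andP ijk; have ik : (i < k)%N by lia.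
apply: ncut_dominates.
- exact: A_start_even AP ik.
- exact: A_zigzag AP ik.
- exact: A_zigzag AP jk.
- exact: ent_left.
by move=> p jp; apply: nq; move: pq; rewrite /position; lia.
Qed.

(** The exchange swaps the starting columns of the rows [i] and [j]. *)
Lemma A_exchange n k P i j q : A n k P -> (i < j < k)%N ->
  first_cut P i j q -> A n k (exchange P i j q).
Proof.
move=> AP ijk [pq cq _]; have [ij jk] := andP ijk; have sP := A_size AP.
have jP : (j < size P)%N by rewrite sP.
have /andP[alti altj] : alternating (row_of (exchange P i j q) i) &&
    alternating (row_of (exchange P i j q) j) by rewrite (alternating_exchange AP).
split.
  split; first by rewrite size_exchange.
  apply/(all_nthP [::]) => m; rewrite size_exchange sP -/(row_of _ m) => mk.
  have [->//|mi] := eqVneq m i; have [->//|mj] := eqVneq m j.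
  by rewrite row_exchange_other //; apply: A_alternating AP mk.
case: AP => _ ord x; rewrite -ord.
pose s m := if m == i then j else if m == j then i else m.
have Es m : ell' (exchange P i j q) m = ell' P (s m).
  suff : start (exchange P i j q) m = start P (s m) by rewrite !startE; lia.
  rewrite /s; have [->|mi] := eqVneq m i; first exact: start_exchange_left.
  have [->|mj] := eqVneq m j; first exact: start_exchange_right.
  exact: start_exchange_other.
have ss m : s (s m) = m by rewrite /s; do !case: eqP => //; lia.
have sk m : (m < k)%N -> (s m < k)%N by rewrite /s; do !case: eqP => //; lia.
apply/mapP/mapP => -[m]; rewrite mem_iota /= => mk ->; exists (s m); rewrite ?mem_iota /= ?sk //.
by rewrite Es ss.
Qed.

(** Left of [q] the two rows are merely interchanged, so the positions there
    that are cuts are the same as before; and [q] itself is a cut. *)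
Lemma first_cut_exchange n k P i j q : A n k P -> (i < j < k)%N ->
  first_cut P i j q -> first_cut (exchange P i j q) i j q.
Proof.
move=> AP ijk [pq cq nq]; have [ij jk] := andP ijk; have ik : (i < k)%N by lia.
have jP : (j < size P)%N by rewrite (A_size AP).
have posE p : position (exchange P i j q) i j p = position P i j p.
  by rewrite /position start_exchange_left // start_exchange_right // andbCA.
have Ei := ent_exchange_left ij jP pq; have Ej := ent_exchange_right ij jP pq.
split=> [||p]; rewrite ?posE // (eq_cut _ Ei Ej).
  by apply: cut_splice; [apply: A_zigzag AP ik|apply: A_zigzag AP jk].
by move=> pp pq'; rewrite cut_splice_lt //; apply: nq.
Qed.

Lemma exchangeK P i j q : (i < j)%N -> (j < size P)%N -> position P i j q ->
  exchange (exchange P i j q) i j q = P.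
Proof.
move=> ij jP pq; have si := start_exchange_left ij jP pq.
have sj := start_exchange_right ij jP pq.
have jP' : (j < size (exchange P i j q))%N by rewrite size_exchange.
have pq' : position (exchange P i j q) i j q.
  by move: pq; rewrite /position si sj; lia.
have Ei := ent_exchange_left ij jP pq; have Ej := ent_exchange_right ij jP pq.
apply: array_ext => [|m _|m _]; first by rewrite !size_exchange.
  have [->|mi] := eqVneq m i; first by rewrite start_exchange_left.
  have [->|mj] := eqVneq m j; first by rewrite start_exchange_right.
  by rewrite !start_exchange_other.
move=> c; have [->|mi] := eqVneq m i.
  by rewrite ent_exchange_left // (eq_splice _ Ej Ei) spliceK.
have [->|mj] := eqVneq m j.
  by rewrite ent_exchange_right // (eq_splice _ Ei Ej) spliceK.
by rewrite !ent_exchange_other.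
Qed.

Lemma exchangeT n k P i j q : A n k P -> (i < j < k)%N ->
    first_cut P i j q ->
  transposable (exchange P i j q) i j /\ T (exchange P i j q) i j = P.
Proof.
move=> AP ijk fq; have AP' := A_exchange AP ijk fq.
have fq' := first_cut_exchange AP ijk fq; have [ij jk] := andP ijk.
rewrite (T_first_cutE AP' ijk fq') exchangeK ?(A_size AP) //; last by case: fq.
by split=> //; apply/(transposableP AP' ijk); case: fq' => *; exists q.
Qed.

End Transposition.

(** * The involution *)
Section Involution.
Local Open Scope ring_scope.
Implicit Types (P : array) (i j m s t : nat) (p q : int).

Definition chain P m : Prop := forall i, (i < m)%N -> below P i i.+1.

Lemma chain_start P m i j : chain P m -> (i < j <= m)%N -> start P j < start P i.
Proof.
move=> cP; elim: j => // j IHj ijm; have [|sji _] := cP j; first by lia.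
have [ij|->//] : (i < j)%N \/ i = j by lia.
by apply: lt_trans sji _; apply: IHj; lia.
Qed.

Lemma find_iota (b : pred nat) N m : (m < N)%N -> b m ->
  (forall i, (i < m)%N -> ~~ b i) -> find b (iota 0 N) = m.
Proof.
move=> mN bm nb; have hb : has b (iota 0 N).
  by apply/hasP; exists m => //; rewrite mem_iota.
have := nth_find 0%N hb; move: (hb); rewrite has_find size_iota => fN.
rewrite nth_iota // add0n => bf; apply/eqP; rewrite eqn_leq.
have -> : (m <= find b (iota 0 N))%N by rewrite leqNgt; apply/negP => /nb; rewrite bf.
rewrite andbT leqNgt; apply/negP => mf.
by have := before_find 0%N mf; rewrite nth_iota // add0n bm.
Qed.

Lemma find_chain n k P m : A n k P -> (m.+1 < k)%N -> chain P m ->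
  transposable P m m.+1 ->
  find (fun i => transposable P i i.+1) (iota 0 k.-1) = m.
Proof.
move=> AP mk cP tm; apply: find_iota => //; first by lia.
by move=> i im; apply/(belowP AP); [lia|apply: cP].
Qed.

Lemma Phi_increasing n k P m : A n k P -> (m.+1 < k)%N -> chain P m ->
    transposable P m m.+1 -> start P m.+1 < start P m ->
  Phi n k P = T P m m.+1.
Proof.
move=> AP mk cP tm lt_s; rewrite /Phi (find_chain AP mk cP tm) ifF; last by lia.
by rewrite (A_sigma_lt AP) ?lt_s //; lia.
Qed.

(** As the starting columns decrease along the chain, the selected row [s] is
    recognized by comparing only the rows [s] and [s.-1] with row [m.+1]. *)
Lemma Phi_decreasing n k P m s : A n k P -> (m.+1 < k)%N -> chain P m ->
    transposable P m m.+1 -> (s <= m)%N ->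
    start P s < start P m.+1 ->
    ((0 < s)%N -> start P m.+1 < start P s.-1) ->
  Phi n k P = if (0 < s)%N && transposable (T P s m.+1) s.-1 s
              then T P s.-1 m.+1 else T P s m.+1.
Proof.
move=> AP mk cP tm sm lt_s lt_s'; rewrite /Phi (find_chain AP mk cP tm) ifF; last by lia.
have lt_m : start P m < start P m.+1.
  have [lt_sm|E] : (s < m)%N \/ m = s by lia.
    by apply: lt_trans lt_s; apply: chain_start cP _; lia.
  by move: lt_s; rewrite -E.
have -> : (sigma n P m < sigma n P m.+1) = false by rewrite (A_sigma_lt AP); lia.
suff -> : find (fun i => sigma n P m.+1 < sigma n P i) (iota 0 m.+1) = s by [].
apply: find_iota => [//||i lt_is]; rewrite (A_sigma_lt AP) //; try by lia.
have := lt_s' ltac:(lia); have [lt_is'|->] : (i < s.-1)%N \/ i = s.-1 by lia.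
  by have := @chain_start P m i s.-1 cP; lia.
by lia.
Qed.

(** Only the two links of the chain at the modified row [t] have to be checked. *)
Lemma chain_exchange P m t q : (t <= m)%N -> (m.+1 < size P)%N -> chain P m ->
    let P' := exchange P t m.+1 q in
    ((0 < t)%N -> below P' t.-1 t) -> ((t < m)%N -> below P' t t.+1) ->
  chain P' m.
Proof.
move=> tm mP cP P' bl br i im.
have [Ei|it] := eqVneq i t; first by rewrite Ei; apply: br; lia.
have [Ei|it'] := eqVneq i.+1 t; first by rewrite -Ei in bl *; apply: bl.
have := cP i im; rewrite /below.
by rewrite !start_exchange_other ?ent_exchange_other //; lia.
Qed.

Lemma below_exchange_pred n k P t j q : A n k P -> (t < j < k)%N -> (0 < t)%N ->
    first_cut P t j q -> start P j < start P t -> below P t.-1 t ->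
  below (exchange P t j q) t.-1 t.
Proof.
case: t => // t AP tjk _ fq lt_s [lt_t dt]; have [tj jk] := andP tjk.
have pq : position P t.+1 j q by case: fq.
have jP : (j < size P)%N by rewrite (A_size AP).
have tt : t != t.+1 by lia.
have tj' : t != j by lia.
split=> [|p] /=; rewrite ?start_exchange_left // [start _ t]start_exchange_other //.
  exact: lt_trans lt_s lt_t.
move=> tp; rewrite [ent _ t]ent_exchange_other //.
rewrite (eq_dominates _ (ent_exchange_left tj jP pq) (frefl _)).
apply: (dominates_splice_above _ lt_t dt _ tp).
  by apply: A_zigzag AP _; lia.
exact: first_cut_dominated AP _ fq lt_s.
Qed.

Lemma below_exchange_succ n k P t j q : A n k P -> (t.+1 < j < k)%N ->
    first_cut P t j q -> start P t < start P j -> below P t t.+1 ->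
  below (exchange P t j q) t t.+1.
Proof.
move=> AP tjk fq lt_s [lt_t dt]; have [tj jk] := andP tjk.
have pq : position P t j q by case: fq.
have tj' : (t < j)%N by lia.
have jP : (j < size P)%N by rewrite (A_size AP).
have tt : t.+1 != t by lia.
have tj'' : t.+1 != j by lia.
split=> [|p]; rewrite ?[start _ t.+1]start_exchange_other // start_exchange_left //.
  exact: lt_trans lt_t lt_s.
rewrite [ent _ t.+1]ent_exchange_other // => tp.
rewrite (eq_dominates _ (frefl _) (ent_exchange_left tj' jP pq)).
apply: (dominates_splice_below _ _ (ltW lt_s) dt _ tp).
- by apply: A_zigzag AP _; lia.
- exact: A_start_even AP jk.
by apply: first_cut_dominates AP _ fq lt_s; lia.
Qed.

(** In the image, row [m] starts where row [m.+1] did and conversely, while the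
    rows before them start further right: the selected row is [m].  The test
    for using row [m.-1] is made on the original array [P], where it fails. *)
Lemma Phi_case_increasing n k P m : A n k P -> (m.+1 < k)%N -> chain P m ->
    transposable P m m.+1 -> start P m.+1 < start P m ->
  Phi n k (T P m m.+1) = P.
Proof.
move=> AP mk cP tm lt_s; have mmk : (m < m.+1 < k)%N by lia.
have mP : (m.+1 < size P)%N by rewrite (A_size AP).
have [q fq ->] := T_first_cut AP mmk tm.
have pq : position P m m.+1 q by case: fq.
have AP' := A_exchange AP mmk fq; have [tm' TP'] := exchangeT AP mmk fq.
have sm := start_exchange_left (ltnSn m) mP pq.
have sm1 := start_exchange_right (ltnSn m) mP pq.
have pred : (0 < m)%N -> below P m.-1 m.
  by move=> m0; have := cP m.-1; rewrite prednK // leqnn; apply.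
have cP' : chain (exchange P m m.+1 q) m.
  apply: chain_exchange => // [m0|]; last by lia.
  exact: below_exchange_pred AP mmk m0 fq lt_s (pred m0).
rewrite (@Phi_decreasing _ _ _ m m AP') ?sm ?sm1 //; last first.
  by move=> m0; rewrite start_exchange_other; [case: (pred m0)|lia..].
rewrite TP' ifF //; apply/negbTE/negP => /andP[m0].
by apply/negP/(belowP AP); [lia|apply: pred].
Qed.

(** In the image, row [m.+1] starts in the column where row [s] did, so the row
    selected there is [s.+1], and the test for using row [s] instead succeeds.
    For [s = m] there is no such row: the rows [m] and [m.+1] have become
    increasing, and they are exchanged at once. *)
Lemma Phi_case_decreasing n k P m s : A n k P -> (m.+1 < k)%N -> chain P m ->
    (s <= m)%N -> start P s < start P m.+1 ->
    ((0 < s)%N -> start P m.+1 < start P s.-1) ->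
    ((0 < s)%N -> ~~ transposable (T P s m.+1) s.-1 s) ->
  Phi n k (T P s m.+1) = P.
Proof.
move=> AP mk cP sm lt_s lt_s'; have smk : (s < m.+1 < k)%N by lia.
have mP : (m.+1 < size P)%N by rewrite (A_size AP).
have [q fq ->] := T_first_cut AP smk (transposable_start AP smk lt_s).
have [pq cq _] := fq.
set P' := exchange P s m.+1 q => nt.
have AP' : A n k P' := A_exchange AP smk fq.
have [ts' TP'] : transposable P' s m.+1 /\ T P' s m.+1 = P := exchangeT AP smk fq.
have smS : (s < m.+1)%N by [].
have ss : start P' s = start P m.+1 := start_exchange_left smS mP pq.
have sm1 : start P' m.+1 = start P s := start_exchange_right smS mP pq.
have cP' : chain P' m.
  apply: chain_exchange => // [s0|lt_sm].
    by apply/(belowP AP'); [lia|apply: nt].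
  by apply: below_exchange_succ AP _ fq lt_s _; [lia|apply: cP].
have [Esm|lt_sm] : s = m \/ (s < m)%N by lia.
  by subst m; rewrite (Phi_increasing AP' mk cP' ts') // ss sm1.
have [lt_ss _] := cP s lt_sm.
have ss1 : start P' s.+1 = start P s.+1 by apply: start_exchange_other; lia.
have s1mk : (s.+1 < m.+1 < k)%N by lia.
have lt_s1 : start P' s.+1 < start P' m.+1 by rewrite ss1 sm1.
have tm' : transposable P' m m.+1.
  apply: (transposable_start AP'); first by lia.
  have [E|lt_s1m] : m = s.+1 \/ (s.+1 < m)%N by lia.
    by move: lt_s1; rewrite -E.
  by apply: lt_trans lt_s1; apply: chain_start cP' _; lia.
rewrite (@Phi_decreasing _ _ _ m s.+1 AP') //=; last by rewrite ss sm1.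
have [q' fq' ->] := T_first_cut AP' s1mk (transposable_start AP' s1mk lt_s1).
have [pq' cq' _] := fq'; have mP' : (m.+1 < size P')%N by rewrite (A_size AP').
rewrite ifT //; apply/(transposableP (A_exchange AP' s1mk fq')); first by lia.
have s1m : (s.+1 < m.+1)%N by [].
exists q.
  rewrite /position start_exchange_left // start_exchange_other; [|lia..].
  by rewrite ss sm1; move: pq; rewrite /position; lia.
rewrite ent_exchange_other; [|lia..].
have Es : ent P' s =1 splice q (ent P m.+1) (ent P s) := ent_exchange_left smS mP pq.
have Em : ent P' m.+1 =1 splice q (ent P s) (ent P m.+1) := ent_exchange_right smS mP pq.
have Es1 : ent P' s.+1 = ent P s.+1 by apply: ent_exchange_other; lia.
rewrite (eq_cut _ Es (ent_exchange_left s1m mP' pq')).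
rewrite (eq_cut _ (frefl _) (eq_splice _ Em (frefl _))) Es1.
apply: (@cut_splice_splice _ _ _ (start P s) (2 * s).+1%:Z).
- by apply: A_zigzag AP _; lia.
- exact: A_zigzag AP mk.
- by apply: A_zigzag AP _; lia.
- by move: pq'; rewrite /position sm1; lia.
- by move: pq; rewrite /position; lia.
- by case: (cP s lt_sm).
- exact: cq.
by move: cq'; rewrite Es1 (eq_cut _ (frefl _) Em).
Qed.

(** In the image, row [m.+1] starts in the column where row [t] did, so the row
    selected there is [t].  The test for using row [t.-1] is made on [P], whose
    rows [t.-1] and [t] are not transposable.  That rows [t] and [m.+1] of [P]
    are transposable holds because otherwise row [m.+1] would dominate row [t];
    so would row [t.+1], hence also the splice of the two, contrary to the
    success of the test. *)
Lemma Phi_case_shifted n k P m t : A n k P -> (m.+1 < k)%N -> chain P m ->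
    (t < m)%N -> start P t.+1 < start P m.+1 ->
    start P m.+1 < start P t ->
    transposable (T P t.+1 m.+1) t t.+1 ->
  transposable P t m.+1 /\ Phi n k (T P t m.+1) = P.
Proof.
move=> AP mk cP tm lt_t1 lt_t; have t1mk : (t.+1 < m.+1 < k)%N by lia.
have mP : (m.+1 < size P)%N by rewrite (A_size AP).
have [q fq ->] := T_first_cut AP t1mk (transposable_start AP t1mk lt_t1).
have [pq cq _] := fq; have AQ := A_exchange AP t1mk fq.
have ttk : (t < t.+1 < k)%N by lia.
case/(transposableP AQ ttk) => c pc.
have tmk : (t < m.+1 < k)%N by lia.
have t1m : (t.+1 < m.+1)%N by [].
rewrite ent_exchange_other; [|lia..].
rewrite (eq_cut _ (frefl _) (ent_exchange_left t1m mP pq)) => cc.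
have [lt_tt dt] := cP t tm.
have tc : start P t <= c <= (2 * t).+1%:Z.
  by move: pc; rewrite /position start_exchange_other; lia.
have nd : ~~ dominates (splice q (ent P m.+1) (ent P t.+1)) (ent P t) c.
  by apply: contraL cc => /dominates_ncut.
have tt : transposable P t m.+1.
  have [//|/(belowP AP tmk)[_ dm]] := boolP (transposable P t m.+1).
  case/negP: nd.
  by apply: dominates_splice; [apply: dt|apply: dm].
split=> //; have [q' fq' ->] := T_first_cut AP tmk tt.
have [pq' _ _] := fq'; set P' := exchange P t m.+1 q'.
have AP' : A n k P' := A_exchange AP tmk fq'.
have [ts' TP'] : transposable P' t m.+1 /\ T P' t m.+1 = P := exchangeT AP tmk fq'.
have tm1 : (t < m.+1)%N by lia.
have st : start P' t = start P m.+1 := start_exchange_left tm1 mP pq'.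
have sm1 : start P' m.+1 = start P t := start_exchange_right tm1 mP pq'.
have pred : (0 < t)%N -> below P t.-1 t.
  by move=> t0; have := cP t.-1; rewrite prednK //; apply; lia.
have cP' : chain P' m.
  apply: (chain_exchange (ltnW tm)) => // [t0|_].
    exact: below_exchange_pred AP tmk t0 fq' lt_t (pred t0).
  split=> [|p]; rewrite st; first by rewrite start_exchange_other //; lia.
  rewrite [ent P' t.+1]ent_exchange_other; [|lia..].
  rewrite (eq_dominates _ (frefl _) (ent_exchange_left tm1 mP pq')).
  apply: (dominates_splice_shifted (ltW lt_t) dt _ _ tc nd).
  - exact: first_cut_dominates AP t1mk fq lt_t1.
  - exact: first_cut_dominated AP tmk fq' lt_t.
  by move: pq'; rewrite /position; lia.
have tm' : transposable P' m m.+1.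
  apply: (transposable_start AP'); first by lia.
  rewrite sm1 start_exchange_other; [|lia..].
  by apply: chain_start cP _; lia.
rewrite (@Phi_decreasing _ _ _ m t AP') ?st ?sm1 ?(ltnW tm) //; last first.
  by move=> t0; rewrite start_exchange_other; [case: (pred t0)|lia..].
rewrite TP' ifF //; apply/negbTE/negP => /andP[t0].
by apply/negP/(belowP AP); [lia|apply: pred].
Qed.

Lemma T_A n k P i j : A n k P -> (i < j < k)%N -> transposable P i j ->
  A n k (T P i j) /\ weight (T P i j) = weight P.
Proof.
move=> AP ijk /(T_first_cut AP ijk)[q fq ->].
split; first exact: A_exchange AP ijk fq.
have /andP[ij jk] := ijk.
by apply: weight_exchange; rewrite ?(A_size AP) //; case: fq.
Qed.

Lemma Phi_correct n k P : A n k P ->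
  [/\ A n k (Phi n k P), weight (Phi n k P) = weight P
    & Phi n k (Phi n k P) = P].
Proof.
move=> AP; pose b i := transposable P i i.+1.
have [nt|] := boolP (has b (iota 0 k.-1)); last first.
  move=> /hasNfind E; have PE : Phi n k P = P.
    by rewrite /Phi E size_iota eqxx.
  by rewrite !PE.
have [m mk [bm nb]] : exists2 m, (m < k.-1)%N & b m /\ forall i, (i < m)%N -> ~~ b i.
  exists (find b (iota 0 k.-1)); first by rewrite -[X in (_ < X)%N](size_iota 0) -has_find.
  have fk : (find b (iota 0 k.-1) < k.-1)%N.
    by rewrite -[X in (_ < X)%N](size_iota 0) -has_find.
  split=> [|i im]; first by have := nth_find 0%N nt; rewrite nth_iota.
  have := before_find 0%N im; rewrite nth_iota => [->//|].
  exact: ltn_trans im fk.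
have {}mk : (m.+1 < k)%N by lia.
have mmk : (m < m.+1 < k)%N by lia.
have cP : chain P m.
  by move=> i im; apply/(belowP AP); [lia|apply: nb].
case: (ltgtP (start P m) (start P m.+1)) => [lt_m|lt_m|E]; last first.
- by have := A_start_inj AP _ mk E; lia.
- rewrite (Phi_increasing AP mk cP bm) //; have [A1 A2] := T_A AP mmk bm.
  by split=> //; apply: Phi_case_increasing.
have exs : exists s, start P s < start P m.+1 by exists m.
case: (ex_minnP exs) => s lt_s min_s; have sm : (s <= m)%N by apply: min_s.
have lt_s' : (0 < s)%N -> start P m.+1 < start P s.-1.
  move=> s0; case: (ltgtP (start P m.+1) (start P s.-1)) => // [lt|E].
    by have := min_s _ lt; lia.
  by have := A_start_inj AP mk _ E; lia.
have smk : (s < m.+1 < k)%N by lia.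
rewrite (Phi_decreasing AP mk cP bm sm) //.
case: ifP => [/andP[s0 tT]|cond]; last first.
  have [A1 A2] := T_A AP smk (transposable_start AP smk lt_s).
  split=> //; apply: Phi_case_decreasing => // s0.
  by move: cond; rewrite s0 /= => ->.
case: s s0 lt_s lt_s' sm smk tT {min_s} => // t _ lt_s /(_ isT) lt_t tm smk tT.
have [tt PhiK] := Phi_case_shifted AP mk cP tm lt_s lt_t tT.
have [|A1 A2] := T_A AP _ tt; [by lia|by split].
Qed.

End Involution.

Unset Implicit Arguments.

Theorem theorem3p1 (n k : nat) (hn : 0 < n) (hk : 0 < k) (P : array)
    (hP : A n k P) :
  [/\ A n k (Phi n k P), weight (Phi n k P) = weight P
    & Phi n k (Phi n k P) = P].
Proof. exact: Phi_correct hP. Qed.
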